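(* Let $A$ be a compact abelian Lie group equipped with the metric $d_A$, and let $s\ge0$, $\ell\ge1$ be given. Then there exists $\varepsilon=\varepsilon(s,\ell,A)>0$ such that the following holds. Suppose $X=(X,C^n(X))$ is a compact ergodic nilspace of degree $s$, and $f\colon X\to A$ is a continuous function such that $d_A(f(x),f(x'))\le\varepsilon$ for all $x,x'\in X$, and $\partial^\ell f\colon C^\ell(X)\to A$ is the zero function. Then $f$ is constant.
   Context: A morphism of discrete cubes $\{0,1\}^m\to\{0,1\}^n$ is a map each of whose coordinate functions is one of $\omega\mapsto 0$, $1$, $\omega_i$, $1-\omega_i$ (for some $i$). A compact cubespace is a compact metric space $X$ with closed subsets $C^n(X)\subseteq X^{\{0,1\}^n}$, $n\ge 0$ (elements are called $n$-cubes), such that $C^0(X)=X$ and $c\circ f\in C^m(X)$ for every $c\in C^n(X)$ and every morphism of discrete cubes $f\colon\{0,1\}^m\to\{0,1\}^n$. $X$ is ergodic if $C^1(X)=X\times X$. An $n$-corner is a map $\lambda\colon\{0,1\}^n\setminus\{\vec 1\}\to X$ whose restriction to each face $\{\omega:\omega_i=0\}$ is an $(n-1)$-cube; $X$ is fibrant if every $n$-corner, $n\ge0$, extends to an $n$-cube. $X$ has $k$-uniqueness if any two $k$-cubes agreeing on $\{0,1\}^k\setminus\{\vec 1\}$ are equal. A nilspace of degree $s$ is a fibrant cubespace with $(s+1)$-uniqueness. For $f\colon X\to A$ with $A$ abelian, $\partial^\ell f(c)=\sum_{\omega\in\{0,1\}^\ell}(-1)^{|\omega|}f(c(\omega))$ for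 $c\in C^\ell(X)$, where $|\omega|=\sum_i\omega_i$. For a compact abelian Lie group $A$ fix an identification $A\cong(\mathbb{R}/\mathbb{Z})^d\times K$, $K$ finite; $d_A((t,k),(t',k'))=(1-[k=k'])+\inf\{\|x-x'\|_2: x,x'\in\mathbb{R}^d,\ x\equiv t,\ x'\equiv t'\pmod 1\}$, where $[k=k']$ is $1$ if $k=k'$ and $0$ otherwise. *)

(* Defs.v *)
From HB Require Import structures.
From mathcomp Require Import all_boot all_order all_algebra.
From mathcomp Require Import generic_quotient ring_quotient.
From mathcomp Require Import all_classical all_reals all_analysis.

Set Implicit Arguments.
Unset Strict Implicit.
Unset Printing Implicit Defensive.

Import Order.TTheory GRing.Theory Num.Theory.
Import numFieldTopology.Exports.

Local Open Scope classical_set_scope.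
Local Open Scope ring_scope.
Local Open Scope quotient_scope.

(* {0,1}^n, with true standing for 1 *)
Definition cube (n : nat) : finType := {ffun 'I_n -> bool}.

Definition vec1 n : cube n := [ffun=> true].

Definition weight n (w : cube n) : nat := (\sum_i w i)%N.

Definition cube_morphism m n (f : cube m -> cube n) : Prop :=
  forall j : 'I_n,
    [\/ forall w, f w j = false, forall w, f w j = true,
        exists i : 'I_m, forall w, f w j = w i |
        exists i : 'I_m, forall w, f w j = ~~ w i].

(* C^n is closed in X^{{0,1}^n} for the product topology, which is the topology
   of {ptws cube n -> X}. *)
Record compact_cubespace (R : realType) := CompactCubespace {
  carrier :> metricType R;
  cubes : forall n, set {ptws cube n -> carrier};
  carrier_compact : compact [set: carrier];
  cubes_closed : forall n, closed (@cubes n);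
  cubes0 : @cubes 0%N = setT;
  cubes_comp : forall m n (c : cube n -> carrier) (f : cube m -> cube n),
    @cubes n c -> cube_morphism f -> @cubes m (c \o f) }.

Arguments cubes {R} X n : rename.

Definition ergodic R (X : compact_cubespace R) : Prop := cubes X 1 = setT.

(* the bijection of {0,1}^(n-1) with the face {w | w_i = 0} of {0,1}^n that
   inserts a 0 at position i *)
Definition face0 n (i : 'I_n) (w : cube n.-1) : cube n :=
  [ffun j => if unlift i j is Some k then w k else false].

Lemma face0_neq1 n (i : 'I_n) (w : cube n.-1) : face0 i w != vec1 n.
Proof.
by apply/eqP => /ffunP /(_ i); rewrite !ffunE unlift_none.
Qed.

Definition punctured_cube n : Type := {w : cube n | w != vec1 n}.

Definition pface0 n (i : 'I_n) (w : cube n.-1) : punctured_cube n :=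
  exist _ (face0 i w) (face0_neq1 i w).

Definition is_corner R (X : compact_cubespace R) n
    (lam : punctured_cube n -> X) : Prop :=
  forall i : 'I_n, cubes X n.-1 (lam \o pface0 i).

Definition fibrant R (X : compact_cubespace R) : Prop :=
  forall n (lam : punctured_cube n -> X), is_corner lam ->
    exists2 c : cube n -> X, cubes X n c & forall w, c (val w) = lam w.

Definition uniqueness R (X : compact_cubespace R) (k : nat) : Prop :=
  forall c c' : cube k -> X, cubes X k c -> cubes X k c' ->
    (forall w, w != vec1 k -> c w = c' w) -> c = c'.

Definition nilspace R (X : compact_cubespace R) (s : nat) : Prop :=
  fibrant X /\ uniqueness X s.+1.

(* The alternating sum is defined for every configuration c; hypotheses on it
   restrict c to cubes. *)
Definition cube_deriv (T : Type) (A : zmodType) (l : nat) (f : T -> A)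
    (c : cube l -> T) : A :=
  \sum_(w : cube l) f (c w) *~ (-1) ^+ weight w.

(* Num.int is a qualifier, whereas ideal_quot takes a zmodClosed predicate. *)
Definition is_int (R : realType) : {pred R} := fun x => x \is a Num.int.

Lemma is_int_zmod_closed (R : realType) : zmod_closed (@is_int R).
Proof. by split=> [|x y]; rewrite !unfold_in; [exact: rpred0 | exact: rpredB]. Qed.

HB.instance Definition _ (R : realType) :=
  GRing.isZmodClosed.Build R (@is_int R) (@is_int_zmod_closed R).

Definition circle (R : realType) : Type := {ideal_quot (@is_int R)}.

HB.instance Definition _ (R : realType) :=
  GRing.Zmodule.copy (circle R) {ideal_quot (@is_int R)}.

Definition circle_pi (R : realType) (x : R) : circle R :=
  \pi_({ideal_quot (@is_int R)}) x.

(* The quotient topology on R/Z. The library's quotient_topology comes with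
   another choiceType structure, which cannot be joined with that of
   {ideal_quot _}. *)
Definition circle_open (R : realType) (U : set (circle R)) : Prop :=
  open (@circle_pi R @^-1` U).

Lemma circle_openT (R : realType) : circle_open [set: circle R].
Proof. by rewrite /circle_open preimage_setT; exact: openT. Qed.

Lemma circle_openI (R : realType) (U V : set (circle R)) :
  circle_open U -> circle_open V -> circle_open (U `&` V).
Proof. by move=> ? ?; exact: openI. Qed.

Lemma circle_open_bigU (R : realType) (I : Type) (U : I -> set (circle R)) :
  (forall i, circle_open (U i)) -> circle_open (\bigcup_i U i).
Proof. by move=> oU; apply: bigcup_open => i _; exact: oU. Qed.

HB.instance Definition _ (R : realType) :=
  isOpenTopological.Build (circle R)
    (@circle_openT R) (@circle_openI R) (@circle_open_bigU R).

Definition torus (R : realType) (d : nat) := 'rV[circle R]_d.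

Definition torus_pi (R : realType) d (x : 'rV[R]_d) : torus R d :=
  map_mx (@circle_pi R) x.

Definition discrete_group (K : finZmodType) : Type := K.
HB.instance Definition _ (K : finZmodType) :=
  GRing.Zmodule.copy (discrete_group K) K.
HB.instance Definition _ (K : finZmodType) :=
  Topological.copy (discrete_group K) (discrete_topology K).

Definition torus_by_finite (R : realType) (d : nat) (K : finZmodType) : Type :=
  (torus R d * discrete_group K)%type.

(* A compact abelian Lie group is a topological abelian group A isomorphic, as a
   topological group, to (R/Z)^d x K for some d and some finite K; a term of
   this type is a choice of such an isomorphism, on which lie_dist depends. *)
Record lie_identification (R : realType) (A : topologicalZmodType)
    (d : nat) (K : finZmodType) := LieIdentification {
  lie_iso :> A -> torus_by_finite R d K;
  lie_inv : torus_by_finite R d K -> A;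
  lie_isoD : {morph lie_iso : a b / a + b};
  lie_isoK : cancel lie_iso lie_inv;
  lie_invK : cancel lie_inv lie_iso;
  lie_iso_continuous : continuous lie_iso;
  lie_inv_continuous : continuous lie_inv }.

Definition l2norm (R : realType) d (x : 'rV[R]_d) : R :=
  Num.sqrt (\sum_i x ord0 i ^+ 2).

Definition torus_dist (R : realType) d (t t' : torus R d) : R :=
  inf [set r | exists x x' : 'rV[R]_d,
    [/\ torus_pi x = t, torus_pi x' = t' & r = l2norm (x - x')]].

Definition lie_dist (R : realType) (A : topologicalZmodType) d K
    (phi : lie_identification R A d K) (a b : A) : R :=
  (1 - ((phi a).2 == (phi b).2)%:R) + torus_dist (phi a).1 (phi b).1.

(* Main.v *)
Require Import Defs.
From HB Require Import structures.
From mathcomp Require Import all_boot all_order all_algebra.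
From mathcomp Require Import generic_quotient ring_quotient.
From mathcomp Require Import all_classical all_reals all_analysis.
From mathcomp Require Import lra.
Import Order.TTheory GRing.Theory Num.Theory.
Import numFieldTopology.Exports.
Local Open Scope classical_set_scope.
Local Open Scope ring_scope.

(** Given [x] and [y], ergodicity and repeated corner completion produce a
    sequence [x = x_0, y = x_1, x_2, ...] such that [w |-> x_|w|] is an
    [n]-cube for every [n]: the faces [w_i = 0] of the [(n+1)]-corner
    [w |-> x_|w|] are all equal to the previous [n]-cube.  The hypothesis on [f]
    then says that [n |-> f (x_n)] has vanishing [l]-th differences.  As [f] has
    small oscillation, this sequence minus [f (x_0)] lifts to a small real
    sequence whose [l]-th differences are integers of absolute value less than
    one, hence zero.  A bounded real sequence with vanishing [l]-th differences
    is constant, so [f x = f y]. *)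

(** * Weights of vertices and alternating sums over discrete cubes *)

Definition cube_cons n (b : bool) (w : cube n) : cube n.+1 :=
  [ffun i => if unlift ord0 i is Some j then w j else b].

Lemma weight_cube_cons n b (w : cube n) :
  weight (cube_cons n b w) = (b + weight w)%N.
Proof.
rewrite /weight big_ord_recl ffunE unlift_none; congr (_ + _)%N.
by apply: eq_bigr => i _; rewrite ffunE liftK.
Qed.

Lemma weight_face0 n (i : 'I_n.+1) (w : cube n) :
  weight (face0 i w) = weight w.
Proof.
rewrite /weight (bigD1_ord i) //= ffunE unlift_none add0n.
by apply: eq_bigr => j _; rewrite ffunE liftK.
Qed.

Lemma weight_vec1 n : weight (vec1 n) = n.
Proof.
rewrite /weight (eq_bigr (fun=> 1%N)) => [|i _]; last by rewrite ffunE.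
by rewrite sum1_card card_ord.
Qed.

Lemma leq_weight n (w : cube n) : (weight w <= n)%N.
Proof.
rewrite -[leqRHS]weight_vec1 /weight; apply: leq_sum => i _.
by rewrite ffunE leq_b1.
Qed.

Lemma weight_lt n (w : cube n) : w != vec1 n -> (weight w < n)%N.
Proof.
move=> w1; rewrite ltn_neqAle leq_weight andbT.
apply: contraNneq w1 => wn; apply/eqP/ffunP => i; rewrite ffunE.
apply/negP => /negP wi; have : (weight w < weight (vec1 n))%N.
  rewrite /weight (bigD1 i) //= [ltnRHS](bigD1 i) //= (negPf wi) ffunE add0n.
  rewrite add1n ltnS; apply: leq_sum => j _.
  by rewrite ffunE leq_b1.
by rewrite wn weight_vec1 ltnn.
Qed.

Lemma sum_cubeS n (V : nmodType) (F : cube n.+1 -> V) :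
  \sum_w F w = \sum_w F (cube_cons n false w) + \sum_w F (cube_cons n true w).
Proof.
rewrite (reindex (fun p : bool * cube n => cube_cons n p.1 p.2)) /=; last first.
  exists (fun w : cube n.+1 => (w ord0, [ffun j => w (lift ord0 j)])).
    move=> [b w] _ /=; congr (_, _); first by rewrite ffunE unlift_none.
    by apply/ffunP => j; rewrite !ffunE liftK.
  move=> w _ /=; apply/ffunP => i; rewrite ffunE.
  by case: unliftP => [j ->|->] //; rewrite ffunE.
by rewrite -(pair_bigA _ (fun b w => F (cube_cons n b w))) big_bool addrC.
Qed.

Lemma cube_deriv_additive (T : Type) (U V : zmodType) l (h : {additive U -> V})
    (f : T -> U) (c : cube l -> T) :
  cube_deriv (h \o f) c = h (cube_deriv f c).
Proof. by rewrite raddf_sum; apply: eq_bigr => w _; rewrite raddfMz. Qed.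

(** In positive dimension the vertices pair up along the first coordinate with opposite signs, so
    constants have zero alternating sum. *)
Lemma cube_derivB_const (T : Type) (V : zmodType) l (f : T -> V) (a : V)
    (c : cube l.+1 -> T) :
  cube_deriv (fun x => f x - a) c = cube_deriv f c.
Proof.
have a0 : cube_deriv (fun=> a) c = 0.
  rewrite /cube_deriv sum_cubeS -big_split big1 // => w _ /=.
  by rewrite !weight_cube_cons add0n add1n exprS mulN1r mulrNz subrr.
by rewrite -[RHS]subr0 -[in RHS]a0 -sumrB; apply: eq_bigr => w _; rewrite mulrzBl.
Qed.

(** Splitting off the first coordinate peels one difference operator from the iterated difference;
    this drives the induction on [l] below. *)
Lemma cube_derivS (V : zmodType) l (u : nat -> V) a :
  cube_deriv u (fun w : cube l.+1 => a + weight w)%N =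
  cube_deriv (fun n => u n - u n.+1) (fun w : cube l => a + weight w)%N.
Proof.
rewrite /cube_deriv sum_cubeS -big_split; apply: eq_bigr => w _ /=.
by rewrite !weight_cube_cons add0n add1n exprS mulN1r mulrNz mulrzBl addnS.
Qed.

Lemma cube_deriv0 (T : Type) (V : zmodType) (f : T -> V) (c : cube 0 -> T) w :
  cube_deriv f c = f (c w).
Proof.
rewrite /cube_deriv (bigD1 w) //= big1 => [|v]; last first.
  by rewrite (_ : v = w) ?eqxx //; apply/ffunP => -[].
by rewrite /weight big_ord0 addr0.
Qed.

(** By induction on [l] the bounded first difference [v] is constant, so [u] is an arithmetic
    progression; boundedness forces its step to be zero. *)
Lemma bounded_cube_deriv0_const (R : archiRealFieldType) l (u : nat -> R) M :
  (forall n, `|u n| <= M) ->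
  (forall a, cube_deriv u (fun w : cube l.+1 => a + weight w)%N = 0) ->
  forall n, u n = u 0%N.
Proof.
elim: l u M => [|l IH] u M uM du.
  elim=> // n <-; move: (du n).
  rewrite cube_derivS (cube_deriv0 _ _ _ _ [ffun=> true]) /weight big_ord0 addn0.
  by move/subr0_eq.
pose v n := u n - u n.+1.
have vM n : `|v n| <= M + M by rewrite (le_trans (ler_normB _ _)) ?lerD.
have vE : forall n, v n = v 0%N.
  by apply: IH vM _ => a; rewrite -cube_derivS.
have uE n : u 0%N - u n = v 0%N *+ n.
  elim: n => [|n IHn]; first by rewrite subrr.
  by rewrite mulrSr -IHn -(vE n) /v addrA subrK.
have v0 : v 0%N = 0.
  apply/eqP/negPn/negP => v0; have v0gt : 0 < `|v 0%N| by rewrite normr_gt0.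
  have M0 : 0 <= M by rewrite (le_trans _ (uM 0%N)).
  (* An integer [n] exceeding [(M + M) / |v 0|] contradicts [|u 0 - u n| <= M + M]. *)
  have := archi_boundP (divr_ge0 (addr_ge0 M0 M0) (ltW v0gt)).
  rewrite ltr_pdivrMr // mulrC mulr_natr -normrMn -uE ltNge.
  by rewrite (le_trans (ler_normB _ _)) ?lerD.
by move=> n; have /esym := uE n; rewrite v0 mul0rn => /esym/subr0_eq.
Qed.

(** * Infinite progressions through two given points *)

Section Progression.
Context {R : realType} {X : compact_cubespace R}.

Definition progression n (u : nat -> X) : Prop :=
  cubes X n (fun w : cube n => u (weight w)).

Lemma progression_extend n u : fibrant X -> progression n u ->
  exists2 v, progression n.+1 v & forall k, (k <= n)%N -> v k = u k.
Proof.
move=> fX un; pose lam (w : punctured_cube n.+1) := u (weight (val w)).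
have [i|c cc cE] := fX n.+1 lam.
  rewrite (_ : lam \o _ = fun w => u (weight w)) //.
  by apply: boolp.funext => w; rewrite /lam /= weight_face0.
(* Only [vec1] has weight [n.+1], so the completed corner still depends on the weight alone; values
   beyond [n.+1] are arbitrary. *)
exists (fun k => if (k <= n)%N then u k else c (vec1 n.+1)); last by move=> k ->.
rewrite /progression (_ : (fun _ => _) = c) //; apply: boolp.funext => w.
have [->|w1] := eqVneq w (vec1 n.+1); first by rewrite weight_vec1 ltnn.
by rewrite -ltnS weight_lt // (cE (exist _ w w1)).
Qed.

Lemma exists_progression (x y : X) : ergodic X -> fibrant X ->
  exists u : nat -> X, [/\ u 0%N = x, u 1%N = y & forall n, progression n.+1 u].
Proof.
move=> eX fX.
(* A state [(n, u)] has its terms settled up to index [n.+1]; each step settles one more, and the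
   diagonal of the states is the required sequence. *)
pose T := {p : nat * (nat -> X) | progression p.1.+1 p.2}.
pose step (p q : T) := (sval q).1 = (sval p).1.+1 /\
  forall k, (k <= (sval p).1.+1)%N -> (sval q).2 k = (sval p).2 k.
have stepP p : {q | step p q}.
  apply: cid; case: p => -[n u] /= un.
  by have [v vn vu] := progression_extend _ _ fX un; exists (exist _ (n.+1, v) vn).
pose u0 k := if k is 0%N then x else y.
have u0P : progression 1 u0 by rewrite /progression (eX : cubes X 1 = _).
have [F [F0 FS]] := dependent_choice stepP (exist _ (0%N, u0) u0P : T).
have F1 n : (sval (F n)).1 = n.
  by elim: n => [|n IH]; [rewrite F0 | rewrite (FS n).1 IH].
have FE m n k : (k <= n.+1)%N ->
    (sval (F (m + n)%N)).2 k = (sval (F n)).2 k.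
  move=> kn; elim: m => // m IH; rewrite addSn (FS _).2 // F1.
  by rewrite (leq_trans kn) // ltnS leq_addl.
exists (fun k => (sval (F k)).2 k); split; first by rewrite F0.
  by rewrite -[F 1%N]/(F (1 + 0)%N) FE // F0.
move=> n; rewrite /progression; have := svalP (F n); rewrite F1 /progression.
congr (cubes X _ _); apply: boolp.funext => w.
(* The diagonal agrees with state [n] up to index [n] by stability, and also at index [n.+1], which
   state [n.+1] inherits. *)
have [wn|nw] := leqP (weight w) n.
  by rewrite -(FE (n - weight w)%N (weight w)) // subnK.
have -> : weight w = (1 + n)%N by apply/anti_leq; rewrite nw leq_weight.
by rewrite FE.
Qed.

(** Setting the last [a] coordinates to 1 is a cube morphism that raises the weight by [a]. *)
Lemma progression_shift l a u : progression (l + a) u ->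
  cubes X l (fun w => u (a + weight w)%N).
Proof.
move=> ula; pose f (w : cube l) : cube (l + a) :=
  [ffun j => if fintype.split j is inl i then w i else true].
have -> : (fun w : cube l => u (a + weight w)%N) =
          (fun w : cube (l + a) => u (weight w)) \o f.
  apply: boolp.funext => w /=; congr (u _); rewrite addnC /weight big_split_ord /=.
  congr (_ + _)%N.
    by apply: eq_bigr => i _; rewrite ffunE (unsplitK (inl i)).
  rewrite (eq_bigr (fun=> 1%N)) ?sum1_card ?card_ord // => i _.
  by rewrite ffunE (unsplitK (inr i)).
apply: cubes_comp ula _ => j; case E: (fintype.split j) => [i|i].
  by constructor 3; exists i => w; rewrite ffunE E.
by constructor 2 => w; rewrite ffunE E.
Qed.

End Progression.

(** * Small real lifts of torus elements *)

Section Torus.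
Context {R : realType}.

HB.instance Definition _ := GRing.isZmodMorphism.Build R (circle R)
  (@circle_pi R) (@pi_is_zmod_morphism _ _ _ {ideal_quot (@is_int R)}).

Lemma circle_pi_eq0 (x : R) : circle_pi x = 0 -> x \is a Num.int.
Proof.
move=> x0; have : circle_pi x = circle_pi 0 by rewrite x0 raddf0.
by move=> /eqP; rewrite /circle_pi -Quotient.idealrBE subr0.
Qed.

Lemma circle_pi_small_eq0 (x : R) : circle_pi x = 0 -> `|x| < 1 -> x = 0.
Proof.
move=> /circle_pi_eq0 /intrP[m ->]; rewrite -intr_norm ltrz1.
by rewrite -[1]add0r ltzD1 normr_le0 => /eqP ->.
Qed.

Lemma torus_pi_surj d (t : torus R d) : exists x : 'rV[R]_d, torus_pi x = t.
Proof.
exists (\row_i repr (t ord0 i)).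
by apply/rowP => i; rewrite !mxE /circle_pi reprK.
Qed.

Lemma l2norm_ge0 d (x : 'rV[R]_d) : 0 <= l2norm x.
Proof. exact: sqrtr_ge0. Qed.

Lemma torus_dist_ge0 d (t t' : torus R d) : 0 <= torus_dist t t'.
Proof.
have [x xt] := torus_pi_surj _ t; have [x' xt'] := torus_pi_surj _ t'.
apply: lb_le_inf; first by exists (l2norm (x - x')), x, x'.
by move=> _ [z [z' [_ _ ->]]]; exact: l2norm_ge0.
Qed.

(** The strict bound leaves room for a pair of lifts nearly attaining the infimum; the Euclidean
    norm of their difference dominates each coordinate. *)
Lemma torus_dist_lift d (t t' : torus R d) (e : R) : torus_dist t t' < e ->
  exists2 x : 'rV[R]_d, torus_pi x = t - t' & forall i, `|x ord0 i| < e.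
Proof.
rewrite /torus_dist; set S := [set r | _] => te.
have S_inf : has_inf S.
  have [x xt] := torus_pi_surj _ t; have [x' xt'] := torus_pi_surj _ t'.
  split; first by exists (l2norm (x - x')), x, x'.
  by exists 0 => _ [z [z' [_ _ ->]]]; exact: l2norm_ge0.
have [|r [x [x' [<- <- ->]]] xe] := inf_adherent (_ : 0 < e - inf S) S_inf.
  by rewrite subr_gt0.
rewrite subrKC in xe; exists (x - x').
  by apply/rowP => i; rewrite !mxE raddfB.
move=> i; apply: le_lt_trans xe.
rewrite -sqrtr_sqr /l2norm ler_wsqrtr // (bigD1 i) //= lerDl.
by apply: sumr_ge0 => j _; exact: sqr_ge0.
Qed.

Definition torus_coord {A : topologicalZmodType} {d : nat} {K : finZmodType}
    (phi : lie_identification R A d K) (i : 'I_d) (a : A) : circle R :=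
  (phi a).1 ord0 i.

Lemma torus_coord_zmod_morphism A d K (phi : lie_identification R A d K) i :
  zmod_morphism (torus_coord phi i).
Proof.
move=> a b; apply: (addIr (torus_coord phi i b)).
by rewrite addrNK -[in RHS](subrK b a) /torus_coord [in RHS]lie_isoD mxE.
Qed.

HB.instance Definition _ A d K (phi : lie_identification R A d K) i :=
  GRing.isZmodMorphism.Build A (circle R) (torus_coord phi i)
    (torus_coord_zmod_morphism A d K phi i).

End Torus.

Theorem theorem5p2 (R : realType) (A : topologicalZmodType)
    (d : nat) (K : finZmodType) (phi : lie_identification R A d K)
    (s l : nat) (hl : (1 <= l)%N) :
  exists eps : R, 0 < eps /\
    forall (X : compact_cubespace R), ergodic X -> nilspace X s ->
    forall f : X -> A, continuous f ->
      (forall x x' : X, lie_dist phi (f x) (f x') <= eps) ->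
      (forall c : cube l -> X, cubes X l c -> cube_deriv f c = 0) ->
    forall x x' : X, f x = f x'.
Proof.
(* [N] counts the vertices of the cube: an alternating sum of [N] terms of size at most [del] is
   below 1 in absolute value. *)
case: l hl => // l _; pose N : R := #|cube l.+1|%:R.
have N0 : 0 < N by rewrite ltr0n; apply/card_gt0P; exists (vec1 l.+1).
pose del : R := (N + 1)^-1.
have del0 : 0 < del by rewrite invr_gt0 addr_gt0.
have Ndel : N * del < 1 by rewrite ltr_pdivrMr ?addr_gt0 // mul1r ltrDl.
have del1 : del < 1 by rewrite invf_lt1 ?addr_gt0 // ltrDr.
(* Halving gives the strict bound [del]; as [del < 1], it also forces equal components in [K]. *)
exists (del / 2); split; first exact: divr_gt0.
move=> X eX [fX _] f _ fsmall fl x y.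
have [u [u0 u1 uP]] := exists_progression x y eX fX.
have small x1 x2 : torus_dist (phi (f x1)).1 (phi (f x2)).1 < del
    /\ (phi (f x1)).2 = (phi (f x2)).2.
  have := fsmall x1 x2; rewrite /lie_dist.
  have := torus_dist_ge0 _ (phi (f x1)).1 (phi (f x2)).1.
  by case: eqVneq => [->|_] /= ? ?; [split=> //; lra | exfalso; lra].
have /choice[v vP] n : exists z : 'rV[R]_d,
    torus_pi z = (phi (f (u n))).1 - (phi (f (u 0%N))).1 /\
    forall i, `|z ord0 i| < del.
  by have [z] := torus_dist_lift _ _ _ _ (small (u n) (u 0%N)).1; exists z.
have v10 : v 1%N = v 0%N.
  apply/rowP => i; pose vi n : R := v n ord0 i.
  have vi_del n : `|vi n| <= del by rewrite ltW // (vP n).2.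
  apply: (bounded_cube_deriv0_const R l vi del vi_del) => a.
  (* The sum projects to zero in the circle because [f] has zero derivative on the shifted
     progression; the triangle inequality bounds its size. *)
  apply: circle_pi_small_eq0.
    rewrite -cube_deriv_additive.
    have -> : @circle_pi R \o vi = fun n =>
        (torus_coord phi i \o (f \o u)) n - torus_coord phi i (f (u 0%N)).
      apply: boolp.funext => n; have := congr1 (fun t : torus R d => t ord0 i) (vP n).1.
      by rewrite !mxE.
    rewrite cube_derivB_const cube_deriv_additive.
    rewrite -[cube_deriv _ _]/(cube_deriv f (fun w => u (a + weight w)%N)).
    rewrite fl ?raddf0 //; apply: progression_shift; exact: uP.
  apply: le_lt_trans Ndel; rewrite mulr_natl -sumr_const.
  apply: le_trans (ler_norm_sum _ _ _) _; apply: ler_sum => w _.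
  by rewrite -mulrzr normrM rmorphXn rmorphN1 normrX normrN1 expr1n mulr1.
rewrite -u0 -u1 -[LHS](lie_isoK phi) -[RHS](lie_isoK phi); congr (lie_inv phi _).
rewrite [LHS]surjective_pairing [RHS]surjective_pairing; congr (_, _).
  by apply/esym/subr0_eq; rewrite -(vP 1%N).1 v10 (vP 0%N).1 subrr.
exact: (small _ _).2.
Qed.
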